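(* Let $V$ be a vector of $n$ values chosen independently and uniformly at random from a set $S$ of size $N\in\Theta(n^2)$, and let $\alpha$ be a constant satisfying $0<\alpha\le 1$. Then for any subset of indices $I\subseteq[n]$ such that $|I|\ge\alpha n$, with constant probability $p$ the following holds: there is at least one repeated value in $V$, and moreover all of the repeated values are constrained to the indices in $I$.
   Context: $[n]=\{1,\dots,n\}$. A repeated value in $V=(V_1,\dots,V_n)$ is a value occurring at two or more distinct indices. ''All repeated values are constrained to the indices in $I$'' means: whenever $V_i=V_j$ with $i\neq j$, both $i,j\in I$. Asymptotic notation is with respect to $n\to\infty$; ''with constant probability $p$'' means that the probability $p$ of the joint event (at least one repeat exists, and every repeat lies inside $I$) is $\Theta(1)$, i.e. bounded below, for all sufficiently large $n$, by a positive constant depending only on $\alpha$ and the constants implicit in $N\in\Theta(n^2)$ (not on $n$ or $I$). *)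

(* Defs.v *)
From HB Require Import structures.
From mathcomp Require Import all_boot all_order all_algebra.
From mathcomp Require Import all_classical all_reals all_analysis.
Set Implicit Arguments.
Unset Strict Implicit.
Unset Printing Implicit Defensive.
Import Order.TTheory GRing.Theory Num.Theory.
Local Open Scope classical_set_scope.
Local Open Scope ring_scope.

(* [f] is in Theta(g) with implicit constants [c1] and [c2]; they are exposed,
   rather than hidden as in [f =Theta_\oo g], so that other constants can be
   required to depend on them only. Meant for [0 < c1], [0 < c2], [0 <= g]. *)
Definition theta_with (R : realType) (c1 c2 : R) (f g : nat -> R) : Prop :=
  \forall n \near \oo, c1 * g n <= f n <= c2 * g n.

(* The finite set [S] carries the discrete sigma-algebra. *)
Definition finite_rv d (T : measurableType d) (S : finType) (X : T -> S) :
  Prop := forall A : set S, measurable (X @^-1` A).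

Definition uniform_rv d (T : measurableType d) (R : realType)
    (P : probability T R) (S : finType) (X : T -> S) : Prop :=
  forall s : S, P (X @^-1` [set s]) = ((#|S|%:R)^-1)%:E.

Definition mutually_independent d (T : measurableType d) (R : realType)
    (P : probability T R) (n : nat) (S : finType) (V : 'I_n -> T -> S) : Prop :=
  forall (J : {set 'I_n}) (A : 'I_n -> set S),
    P [set w | forall i, i \in J -> A i (V i w)] =
    (\prod_(i in J) P (V i @^-1` A i))%E.

Definition independent_uniform d (T : measurableType d) (R : realType)
    (P : probability T R) (n : nat) (S : finType) (V : 'I_n -> T -> S) : Prop :=
  [/\ forall i, finite_rv (V i),
      forall i, uniform_rv P (V i)
    & mutually_independent P V].

Definition repeated_value (n : nat) (S : Type) (v : 'I_n -> S) (s : S) : Prop :=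
  exists i j : 'I_n, [/\ i <> j, v i = s & v j = s].

Definition repeats_constrained_to (n : nat) (S : Type) (I : {set 'I_n})
    (v : 'I_n -> S) : Prop :=
  forall i j : 'I_n, i <> j -> v i = v j -> i \in I /\ j \in I.

(* Main.v *)
Require Import Defs.
From HB Require Import structures.
From mathcomp Require Import all_boot all_order all_algebra.
From mathcomp Require Import all_classical all_reals all_analysis.
From mathcomp Require Import ring lra.
Import Order.TTheory GRing.Theory Num.Theory.
Local Open Scope classical_set_scope.
Local Open Scope ring_scope.

(* For i < j in I, consider the event that V_i = V_j while V is otherwise
   injective.  These events are pairwise disjoint, each has probability
   N^_(n-1) / N^n, and there are about (alpha n)^2 / 2 of them.  Since
   N^_(n-1) / N^(n-1) >= (1 - n/N)^n >= exp(-2n^2/N) once n <= N/2, the total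
   is at least alpha^2 / (4 c2) * exp(-2/c1). *)

(** * Counting pairs in [I] and vectors with a single collision *)

Definition ltn_pairs {n} (I : {set 'I_n}) : {set 'I_n * 'I_n} :=
  [set p in finset.setX I I | (p.1 < p.2)%N]%SET.

(** The square [I * I] splits into increasing pairs, the diagonal (a copy of [I]) and decreasing
    pairs, which the swap matches with the increasing ones. The additive form avoids truncated
    subtraction. *)
Lemma card_ltn_pairs n (I : {set 'I_n}) :
  (2 * #|ltn_pairs I| + #|I| = #|I| * #|I|)%N.
Proof.
rewrite -cardsX.
rewrite -(cardsID [set p : 'I_n * 'I_n | (p.1 < p.2)%N]%SET (finset.setX I I)).
have <- : ltn_pairs I =
    finset.setI (finset.setX I I) [set p : 'I_n * 'I_n | (p.1 < p.2)%N]%SET.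
  by apply/setP => p; rewrite !inE.
rewrite mul2n -addnn -addnA; congr addn.
rewrite -(cardsID [set p : 'I_n * 'I_n | p.1 == p.2]%SET (finset.setD _ _)).
rewrite addnC; congr addn.
- rewrite -(card_imset _ (f := fun i : 'I_n => (i, i))); last by move=> ? ? [].
  apply: eq_card => -[i j]; apply/imsetP/idP; rewrite !inE /=.
    by case=> k kI [-> ->]; rewrite kI eqxx ltnn.
  by case/andP=> /andP[_ /andP[iI _]] /eqP <-; exists i.
- rewrite -[LHS](card_imset _ (f := fun p => (p.2, p.1))); last first.
    by move=> [? ?] [? ?] [-> ->].
  apply: eq_card => -[i j]; apply/imsetP/idP; rewrite !inE /=.
    case=> -[k l]; rewrite !inE /= => /andP[/andP[kI lI] kl] [-> ->].
    by rewrite kI lI -leqNgt (ltnW kl) -val_eqE /= gtn_eqF.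
  case/and3P=> ij; rewrite -leqNgt => ji /andP[iI jI]; exists (j, i) => //.
  by rewrite !inE /= iI jI ltn_neqAle ji andbT val_eqE eq_sym ij.
Qed.

(* Identifies i with j; the default [ord0] is only reached when i = j. *)
Definition merge_ord {m} (i j k : 'I_m.+2) : 'I_m.+1 :=
  odflt (odflt ord0 (unlift i j)) (unlift i k).

Lemma merge_ord_lift m (i j : 'I_m.+2) k : merge_ord i j (lift i k) = k.
Proof. by rewrite /merge_ord liftK. Qed.

(** Away from [i] the map inverts [lift i], hence is injective; [i] itself is sent where [j] goes,
    so this is the only collision. *)
Lemma merge_ord_eq m (i j k l : 'I_m.+2) : i != j ->
  merge_ord i j k = merge_ord i j l ->
  [\/ k = l, k = i /\ l = j | k = j /\ l = i].
Proof.
move=> ij; rewrite /merge_ord.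
case: (unliftP i j) ij => [j' ->|->]; last by rewrite eqxx.
move=> _ /=; case: (unliftP i k) => [k' ->|->];
  case: (unliftP i l) => [l' ->|->] /=.
- by move=> ->; constructor 1.
- by move=> ->; constructor 3.
- by move=> ->; constructor 2.
- by constructor 1.
Qed.

Definition good_vectors {n} (S : finType) (I : {set 'I_n}) :
    {set {ffun 'I_n -> S}} :=
  [set f : {ffun 'I_n -> S} | `[< (exists s, repeated_value f s) /\
                                  repeats_constrained_to I f >]]%SET.

(** Composing an injective [g] on [m.+1] places with [merge_ord i j] gives a vector whose only
    collision is between [i] and [j]. Pair and [g] can both be recovered from it, so the products
    counted on the left embed into the good vectors. *)
Lemma card_good_vectors m (S : finType) (I : {set 'I_m.+2}) :
  (#|ltn_pairs I| * #|S| ^_ m.+1 <= #|good_vectors S I|)%N.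
Proof.
pose D := finset.setX (ltn_pairs I)
  [set g : {ffun 'I_m.+1 -> S} | injectiveb g]%SET.
pose dup (p : ('I_m.+2 * 'I_m.+2) * {ffun 'I_m.+1 -> S}) :=
  [ffun k => p.2 (merge_ord p.1.1 p.1.2 k)].
have dup_repeat (i j : 'I_m.+2) (g : {ffun 'I_m.+1 -> S}) k l :
    (i < j)%N -> injective g ->
    dup ((i, j), g) k = dup ((i, j), g) l ->
    [\/ k = l, k = i /\ l = j | k = j /\ l = i].
  move=> ij g_inj; rewrite !ffunE /= => /g_inj; apply: merge_ord_eq.
  by rewrite -val_eqE /= ltn_eqF.
have dup_eq (i j : 'I_m.+2) (g : {ffun 'I_m.+1 -> S}) :
    (i < j)%N -> dup ((i, j), g) i = dup ((i, j), g) j.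
  move=> ij; rewrite !ffunE /= /merge_ord unlift_none.
  by case: (unliftP i j) ij => [? ->|->] //=; rewrite ltnn.
have dup_inj : {in D &, injective dup}.
  move=> [[i j] g] [[i' j'] g']; rewrite !inE /=.
  move=> /andP[/andP[_ ij] /injectiveP g_inj].
  move=> /andP[/andP[_ ij'] /injectiveP g'_inj] eq_dup.
  (* The colliding positions determine the pair up to order, and [i < j], [i' < j'] rule out the
     swap. *)
  have ii'jj' : i = i' /\ j = j'.
    have := dup_eq i j g ij; rewrite eq_dup => /dup_repeat.
    case/(_ ij' g'_inj) => [eij|[]//|[eij eji]].
      by rewrite eij ltnn in ij.
    by move: ij; rewrite eij eji ltnNge ltnW.
  (* Reading the vector along [lift i] gives back [g]. *)
  case: ii'jj' eq_dup => <- <- eq_dup; congr (_, _); apply/ffunP => k.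
  by move/ffunP: eq_dup => /(_ (lift i k)); rewrite !ffunE /= merge_ord_lift.
have <- : #|dup @: D|%SET = (#|ltn_pairs I| * #|S| ^_ m.+1)%N.
  by rewrite card_in_imset // cardsX card_inj_ffuns card_ord.
apply/subset_leq_card/fintype.subsetP => _ /imsetP[[[i j] g] Dp ->].
move: Dp; rewrite !inE /= => /andP[/andP[/andP[iI jI] ij] /injectiveP g_inj].
split.
  exists (dup ((i, j), g) i); exists i, j; split=> //.
    by move=> eij; rewrite eij ltnn in ij.
  by rewrite -dup_eq.
by move=> k l kl /dup_repeat[]// [-> ->].
Qed.

(** * From probabilities to counting *)

Section finite_random_variables.
Context {R : realType} {d : measure_display} {T : measurableType d}
  (P : probability T R).

Lemma finite_rv_pointwise (S : finType) (X : T -> S) :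
  (forall s, measurable (X @^-1` [set s])) -> finite_rv X.
Proof.
move=> mX A; rewrite -(image_id A) -bigcup_imset1 preimage_bigcup.
by apply: fin_bigcup_measurable => //; exact: finite_finset.
Qed.

Lemma uniform_probability (S : finType) (X : T -> S) (A : {set S}) :
  finite_rv X -> uniform_rv P X ->
  P (X @^-1` [set` A]) = (#|A|%:R / #|S|%:R)%:E.
Proof.
move=> mX uX.
rewrite -[X in _ @^-1` X]image_id -bigcup_imset1 preimage_bigcup.
rewrite measure_fin_bigcup;
  [|exact: finite_finset|exact: trivIset_preimage1|by []].
(* A duplicate-free enumeration turns the sum over a finite set into an ordinary big sum. *)
have -> : [set` A] = [set` enum A].
  by apply/seteqP; split=> s /=; rewrite mem_enum.
rewrite -fsbig_seq ?enum_uniq // big_enum /=.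
under eq_bigr do rewrite uX.
by rewrite sumEFin sumr_const mulr_natl.
Qed.

Definition joint {n} {S : finType} (V : 'I_n -> T -> S) (w : T) :
  {ffun 'I_n -> S} := [ffun i => V i w].

Lemma joint_fiber n (S : finType) (V : 'I_n -> T -> S) f :
  joint V @^-1` [set f] = [set w | forall i, i \in [set: 'I_n]%SET ->
                                             [set f i] (V i w)].
Proof.
apply/seteqP; split=> w /=.
  by move=> <- i _; rewrite ffunE.
by move=> Vf; apply/ffunP => i; rewrite ffunE Vf ?inE.
Qed.

Lemma finite_rv_joint n (S : finType) (V : 'I_n -> T -> S) :
  (forall i, finite_rv (V i)) -> finite_rv (joint V).
Proof.
move=> mV; apply: finite_rv_pointwise => f; rewrite joint_fiber.
have -> : [set w | forall i, i \in [set: 'I_n]%SET -> [set f i] (V i w)] =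
    \bigcap_(i in [set: 'I_n]) V i @^-1` [set f i].
  by apply/seteqP; split=> w Vf i _ ; apply: Vf; rewrite ?inE.
by apply: fin_bigcap_measurable => [|i _]; [exact: finite_finset|exact: mV].
Qed.

(** Independence is applied to all indices at once with singleton events; it reduces the probability
    of an event on [V] to a count of vectors. *)
Lemma uniform_rv_joint n (S : finType) (V : 'I_n -> T -> S) :
  independent_uniform P V -> uniform_rv P (joint V).
Proof.
move=> [mV uV iV] f; rewrite joint_fiber (iV _ (fun i => [set f i])).
under eq_bigr do rewrite uV.
rewrite prodEFin prodr_const cardsT card_ord card_ffun card_ord.
by rewrite natrX exprVn.
Qed.

End finite_random_variables.

(** * Numerical estimates *)

Lemma leq_expn_ffact (N m : nat) : ((N - m) ^ m <= N ^_ m)%N.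
Proof.
rewrite ffact_prod -[X in (_ ^ X)%N](card_ord m) -prod_nat_const.
by apply: leq_prod => i _; rewrite leq_sub2l // ltnW.
Qed.

(** Since [expR (2 * x) >= 1 + 2 * x], it is enough that [(1 - x) * (1 + 2 * x) = 1 + x * (1 - 2 *
    x)] is at least 1. *)
Lemma expR_le_1B (R : realType) (x : R) :
  0 <= x <= 1 / 2 -> expR (- (2 * x)) <= 1 - x.
Proof.
move=> /andP[x0 x1]; have e2x := expR_ge1Dx (2 * x).
rewrite expRN -[X in X <= _]div1r ler_pdivrMr ?expR_gt0 //.
apply: le_trans (ler_wpM2l _ e2x); last by lra.
by nra.
Qed.

Lemma ffact_ratio_ge (R : realType) (c : R) (N m : nat) :
  0 < c -> 2 <= c * m.+1%:R -> c * m.+1%:R ^+ 2 <= N%:R ->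
  expR (- (2 / c)) <= (N ^_ m)%:R / N%:R ^+ m.
Proof.
move=> c0 cm cN.
have m0 : 0 < m.+1%:R :> R by rewrite ltr0n.
have mm : m%:R <= m.+1%:R :> R by rewrite ler_nat.
(* Here [m.+1] is the length of the vector. It is large enough for the quadratic bound on [N] to
   give a linear one, which puts [m / N] in the range of [expR_le_1B]. *)
have N2m : 2 * m.+1%:R <= N%:R :> R.
  by apply: le_trans cN; rewrite expr2 mulrA ler_wpM2r // ltW.
have N0 : 0 < N%:R :> R by apply: lt_le_trans N2m; rewrite mulr_gt0.
have leNm : (m <= N)%N by rewrite -(ler_nat R); lra.
pose x : R := m%:R / N%:R.
have x01 : 0 <= x <= 1 / 2.
  by rewrite divr_ge0 //= ler_pdivrMr //; lra.
have expx : expR (- (2 / c)) <= expR (- (2 * x)) ^+ m.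
  rewrite -expRM_natl ler_expR mulrN lerN2 ler_pdivlMr //.
  have -> : m%:R * (2 * x) * c = 2 * (c * m%:R ^+ 2) / N%:R.
    by rewrite /x; field; rewrite gt_eqF.
  rewrite ler_pdivrMr // ler_wpM2l //; apply: le_trans cN.
  by rewrite ler_wpM2l ?ler_sqr ?nnegrE ?ler0n ?(ltW c0).
apply: (le_trans expx).
apply: (@le_trans _ _ ((1 - x) ^+ m)).
  by rewrite lerXn2r ?nnegrE ?expR_ge0 ?expR_le_1B //; lra.
have -> : 1 - x = (N - m)%:R / N%:R.
  by rewrite natrB // mulrBl divff ?gt_eqF.
by rewrite expr_div_n ler_pM2r ?invr_gt0 ?exprn_gt0 // -natrX ler_nat leq_expn_ffact.
Qed.

Lemma ltn_pairs_ratio_ge (R : realType) (alpha c : R) (N n : nat)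
    (I : {set 'I_n}) :
  0 < c -> (0 < N)%N -> 2 <= alpha * n%:R -> alpha * n%:R <= #|I|%:R ->
  N%:R <= c * n%:R ^+ 2 ->
  alpha ^+ 2 / (4 * c) <= #|ltn_pairs I|%:R / N%:R.
Proof.
move=> c0 N0 an aI Nn.
have L2 : 2 * #|ltn_pairs I|%:R + #|I|%:R = #|I|%:R ^+ 2 :> R.
  by rewrite -natrM -natrD card_ltn_pairs -natrX.
(* As [#|I| >= 2], the term [#|I|] is at most half of [#|I| ^ 2]; this is the origin of the 4. *)
have L4 : (alpha * n%:R) ^+ 2 <= 4 * #|ltn_pairs I|%:R by nra.
rewrite ler_pdivrMr ?mulr_gt0 // mulrAC ler_pdivlMr ?ltr0n //.
apply: (le_trans (ler_wpM2l (sqr_ge0 _) Nn)).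
by have := ler_wpM2l (ltW c0) L4; lra.
Qed.

(** * The bound for a fixed length, then for all large lengths *)

Lemma probability_good_vectors_ge (R : realType) (alpha c1 c2 : R) (n : nat)
    (S : finType) (d : measure_display) (T : measurableType d)
    (P : probability T R) (V : 'I_n -> T -> S) (I : {set 'I_n}) :
  0 < alpha <= 1 -> 0 < c1 -> 0 < c2 ->
  2 <= c1 * n%:R -> 2 <= alpha * n%:R ->
  c1 * n%:R ^+ 2 <= #|S|%:R -> #|S|%:R <= c2 * n%:R ^+ 2 ->
  independent_uniform P V -> alpha * n%:R <= #|I|%:R ->
  ((alpha ^+ 2 / (4 * c2) * expR (- (2 / c1)))%:E <=
   P [set w | (exists s, repeated_value (V^~ w) s) /\
              repeats_constrained_to I (V^~ w)])%E.
Proof.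
case/andP=> a0 a1 hc1 hc2.
(* Lengths 0 and 1 contradict [2 <= alpha * n] with [alpha <= 1]; [merge_ord] needs the form
   [m.+2]. *)
case: n V I => [|[|m]] V I c1n an SnL SnU iuV aI.
- by rewrite mulr0 in an; exfalso; lra.
- by rewrite mulr1 in an; exfalso; lra.
have S0 : 0 < #|S|%:R :> R.
  by apply: lt_le_trans SnL; rewrite mulr_gt0 // exprn_gt0 // ltr0n.
have -> : [set w | (exists s, repeated_value (V^~ w) s) /\
                   repeats_constrained_to I (V^~ w)] =
    joint V @^-1` [set` good_vectors S I].
  have Vw w : (joint V w : 'I_m.+2 -> S) = V^~ w.
    by apply/funext => i; rewrite ffunE.
  by apply/seteqP; split=> w /=; rewrite inE /= Vw => /asboolP.
have [mV _ _] := iuV.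
rewrite uniform_probability; [|exact: finite_rv_joint|exact: uniform_rv_joint].
rewrite lee_fin card_ffun card_ord natrX.
(* One factor [#|S|] of the denominator goes to the pairs, the other [m.+1] to the falling
   factorial. *)
apply: (@le_trans _ _ (#|ltn_pairs I|%:R / #|S|%:R *
                       ((#|S| ^_ m.+1)%:R / #|S|%:R ^+ m.+1))).
  apply: ler_pM.
  - by rewrite divr_ge0 ?exprn_ge0 ?mulr_ge0 // ltW.
  - exact: expR_ge0.
  - by apply: (@ltn_pairs_ratio_ge _ _ _ _ m.+2) => //; rewrite -(ltr0n R).
  - exact: ffact_ratio_ge.
rewrite mulf_div -exprS -natrM ler_pM2r ?invr_gt0 ?exprn_gt0 //.
by rewrite ler_nat card_good_vectors.
Qed.

Theorem lemma4 (R : realType) (alpha c1 c2 : R)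
    (halpha : 0 < alpha <= 1) (hc1 : 0 < c1) (hc2 : 0 < c2) :
  exists2 p : R, 0 < p &
    forall S : nat -> finType,
      theta_with c1 c2 (fun n => #|S n|%:R) (fun n => n%:R ^+ 2) ->
      \forall n \near \oo,
        forall (d : measure_display) (T : measurableType d)
               (P : probability T R) (V : 'I_n -> T -> S n),
          independent_uniform P V ->
          forall I : {set 'I_n}, alpha * n%:R <= #|I|%:R ->
            (p%:E <= P [set w | (exists s, repeated_value (V^~ w) s) /\
                                repeats_constrained_to I (V^~ w)])%E.
Proof.
have /andP[a0 _] := halpha.
(* The upper constant [c2] enters through the density of pairs, the lower constant [c1] through the
   injectivity estimate. *)
exists (alpha ^+ 2 / (4 * c2) * expR (- (2 / c1))).
  by rewrite mulr_gt0 ?expR_gt0 ?divr_gt0 ?exprn_gt0 ?mulr_gt0.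
move=> S thetaS.
(* The threshold is fixed before [T], [P], [V] and [I] are introduced, so it is uniform in them: [n]
   must exceed [2 / alpha] and [2 / c1] and lie in the range of the Theta bounds. *)
near=> n.
have : c1 * n%:R ^+ 2 <= #|S n|%:R <= c2 * n%:R ^+ 2 by near: n.
have : 2 <= alpha * n%:R.
  by rewrite -ler_pdivrMl //; near: n; exact: nbhs_infty_ger.
have : 2 <= c1 * n%:R.
  by rewrite -ler_pdivrMl //; near: n; exact: nbhs_infty_ger.
move=> c1n an /andP[SnL SnU] d T P V iuV I aI.
exact: probability_good_vectors_ge.
Unshelve. all: by end_near.
Qed.
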